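(* Let $(X,d,\mu,\mathcal{E},\mathcal{F})$ be a Dirichlet space satisfying the standing assumptions (A1)–(A3), (HK), (BE) stated in the context, and let $0<\delta<1$. Assume $d_H>\delta d_W$. There exists a constant $C>0$ such that for every $f\in\mathbf{B}^{1,1}(X)$, $$\|f\|_{L^q(X,\mu)}\le C\int_X\int_X\frac{|f(x)-f(y)|}{d(x,y)^{d_H+\delta d_W}}\,d\mu(y)\,d\mu(x),$$ where $q=\frac{d_H}{d_H-\delta d_W}$.
   Context: Setting. $(X,d,\mu)$ is a locally compact metric measure space, $\mu$ a Radon measure supported on $X$, and $(\mathcal{E},\mathcal{F})$ is a Dirichlet form on $L^2(X,\mu)$ with heat semigroup $\{P_t\}_{t>0}$ and generator $L$. Write $B(x,r)=\{y: d(x,y)<r\}$. For $\lambda>0$, $1\le p<\infty$, $KS^{\lambda,p}(X)$ is the set of $f\in L^p(X,\mu)$ with $\limsup_{r\to0^+}\int_X\int_{B(x,r)}\frac{|f(x)-f(y)|^p}{r^{\lambda p}\mu(B(x,r))}d\mu(y)d\mu(x)<\infty$. Standing assumptions. (A1) Every ball $B(x,r)$ has compact closure. (A2) There are $c_1,c_2,d_H>0$ with $c_1r^{d_H}\le\mu(B(x,r))\le c_2r^{d_H}$ for all $x\in X$, $r\ge0$. (A3) $(\mathcal{E},\mathcal{F})$ is regular and strongly local. (HK) $\{P_t\}$ has a continuous heat kernel $p_t(x,y)$ and there are $c_3,c_4,c_5,c_6\in(0,\infty)$, $d_W\in[2,\infty)$ with $c_5t^{-d_H/d_W}\exp(-c_6(d(x,y)^{d_W}/t)^{1/(d_W-1)})\le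 p_t(x,y)\le c_3t^{-d_H/d_W}\exp(-c_4(d(x,y)^{d_W}/t)^{1/(d_W-1)})$ for $\mu\times\mu$-a.e. $(x,y)$ and every $t>0$. (BE) There is $C>0$ such that $|P_tg(x)-P_tg(y)|\le C\frac{d(x,y)^\kappa}{t^{\kappa/d_W}}\|g\|_{L^\infty(X,\mu)}$ for all $t>0$, $g\in L^\infty(X,\mu)$, $x,y\in X$, where $0<\kappa<d_W$ is defined by $d_W-\kappa=\sup\{\lambda>0: KS^{\lambda,1}(X)\text{ contains non-constant functions}\}$. Subordinated semigroup. For fixed $0<\delta<1$ let $\eta^{(\delta)}_t\ge0$ be the continuous function with $\int_0^\infty\eta^{(\delta)}_t(s)e^{-s\lambda}ds=e^{-t\lambda^\delta}$ for $\lambda>0$. The semigroup with generator given by the fractional Laplacian $(-L)^\delta$ is $P^{(\delta)}_tf=\int_0^\infty\eta^{(\delta)}_t(s)P_sf\,ds$, with heat kernel $p^{(\delta)}_t(x,y)=\int_0^\infty\eta^{(\delta)}_t(s)p_s(x,y)ds$. Besov classes. For $p\ge1$, $\alpha\ge0$: $\|f\|_{p,\alpha}=\sup_{t>0}t^{-\alpha}\left(\int_X\int_X|f(x)-f(y)|^pp^{(\delta)}_t(x,y)d\mu(x)d\mu(y)\right)^{1/p}$ and $\mathbf{B}^{p,\alpha}(X)=\{f\in L^p(X,\mu):\|f\|_{p,\alpha}<\infty\}$. *)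

(* Defs.v *)
From HB Require Import structures.
From mathcomp Require Import all_boot all_order all_algebra.
From mathcomp Require Import all_classical all_reals all_analysis.

Set Implicit Arguments.
Unset Strict Implicit.
Unset Printing Implicit Defensive.

Import Order.TTheory GRing.Theory Num.Theory.
Import numFieldNormedType.Exports.

Local Open Scope classical_set_scope.
Local Open Scope ring_scope.

HB.mixin Record Metric_isBorel (K : numDomainType) d M
    of Metric K M & Measurable d M := {
  borel_measurableE : @measurable d M = <<s [set U : set M | open U] >>
}.

#[short(type="borelMetricType")]
HB.structure Definition BorelMetric (K : numDomainType) d :=
  {M of Metric K M & Measurable d M & Metric_isBorel K d M}.

Section measures.
Context {R : realType} {d : measure_display} {X : borelMetricType R d}.
Variable mu : {measure set X -> \bar R}.
Local Open Scope ereal_scope.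

Definition radon_measure : Prop :=
  [/\ forall K : set X, compact K -> mu K < +oo,
      forall A : set X, measurable A ->
        mu A = ereal_inf [set mu U | U in [set U | open U /\ A `<=` U]]
    & forall U : set X, open U ->
        mu U = ereal_sup [set mu K | K in [set K | compact K /\ K `<=` U]]].

Definition full_support : Prop :=
  forall U : set X, open U -> U !=set0 -> 0 < mu U.

Definition ahlfors_regular (dH : R) : Prop :=
  (0 < dH)%R /\ exists c1 c2 : R, [/\ (0 < c1)%R, (0 < c2)%R &
    forall (x : X) (r : R), (0 <= r)%R ->
      (c1 * r `^ dH)%:E <= mu (ball x r) <= (c2 * r `^ dH)%:E].

Definition KS_energy (lambda p : R) (f : X -> R) (r : R) : \bar R :=
  \int[mu]_x \int[mu]_(y in ball x r)
    (`|f x - f y| `^ p / (r `^ (lambda * p) * fine (mu (ball x r))))%:E.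

Definition KS (lambda p : R) : set (X -> R) :=
  [set f | f \in Lfun mu p%:E /\
           limf_esup (KS_energy lambda p f) (0%R : R)^'+ < +oo].

Definition ae_nonconstant (f : X -> R) : Prop :=
  ~ exists c : R, {ae mu, forall x, f x = c}.

End measures.

Section dirichlet_forms.
Context {R : realType} {d : measure_display} {X : borelMetricType R d}.
Variable mu : {measure set X -> \bar R}.
Implicit Types (f g h u v : X -> R) (F : set (X -> R)).
Implicit Types (E : (X -> R) -> (X -> R) -> R).

Definition L2dot f g : R := \int[mu]_x (f x * g x).
Definition L2norm f : \bar R := ('N[mu]_2%:E [EFin \o f])%E.

Definition unit_contraction f : X -> R := fun x => Num.min (Num.max (f x) 0) 1.

Definition form1 E f g : R := E f g + L2dot f g.

(* Elements of L^2 are represented by Borel functions, hence the closure of F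
   and the invariance of E under a.e. equality. *)
Record dirichlet_form F E : Prop := {
  df_L2 : forall f, F f -> f \in Lfun mu 2%:E ;
  df_ae : forall f g, F f -> g \in Lfun mu 2%:E ->
    {ae mu, forall x, f x = g x} -> F g ;
  df_form_ae : forall f g h, F f -> F g -> F h ->
    {ae mu, forall x, f x = g x} -> E f h = E g h ;
  df_zero : F (fun=> 0) ;
  df_lin : forall (a : R) f g, F f -> F g -> F (fun x => a * f x + g x) ;
  df_dense : forall f (e : R), f \in Lfun mu 2%:E -> 0 < e ->
    exists2 g, F g & (L2norm (f \- g)%R < e%:E)%E ;
  df_form_lin : forall (a : R) f g h, F f -> F g -> F h ->
    E (fun x => a * f x + g x) h = a * E f h + E g h ;
  df_form_sym : forall f g, F f -> F g -> E f g = E g f ;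
  df_form_ge0 : forall f, F f -> 0 <= E f f ;
  df_closed : forall u : nat -> X -> R, (forall n, F (u n)) ->
    (forall e : R, 0 < e -> exists N : nat, forall m n : nat,
       (N <= m)%N -> (N <= n)%N -> form1 E (u m \- u n) (u m \- u n) < e) ->
    exists2 f, F f & form1 E (u n \- f) (u n \- f) @[n --> \oo] --> (0 : R) ;
  df_markov : forall f, F f ->
    F (unit_contraction f) /\
    E (unit_contraction f) (unit_contraction f) <= E f f
}.

Definition compactly_supported_continuous f : Prop :=
  continuous f /\ compact (closure [set x | f x != 0]).

Definition regular_form F E : Prop :=
  (forall f (e : R), F f -> 0 < e ->
     exists g, [/\ F g, compactly_supported_continuous g &
       form1 E (f \- g) (f \- g) < e]) /\
  (forall f (e : R), compactly_supported_continuous f -> 0 < e ->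
     exists g, [/\ F g, compactly_supported_continuous g &
       forall x, `|f x - g x| <= e]).

(* The support of the measure |f| dmu, which only depends on the a.e. class of f;
   it is [closure [set x | f x != 0]] when f is continuous and mu has full
   support. *)
Definition ess_support f : set X :=
  ~` \bigcup_(U in [set U | open U /\ {ae mu, forall x, U x -> f x = 0}]) U.

Definition strongly_local F E : Prop :=
  forall u v (U : set X) (c : R), F u -> F v ->
    compact (ess_support u) -> compact (ess_support v) ->
    open U -> ess_support v `<=` U -> {ae mu, forall x, U x -> u x = c} ->
    E u v = 0.

(* [form_generator F E f h] reads: f is in the domain of L and L f = h. *)
Definition form_generator F E f h : Prop :=
  [/\ F f, h \in Lfun mu 2%:E & forall g, F g -> E f g = - L2dot h g].

Implicit Type P : R -> (X -> R) -> (X -> R).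

Definition semigroup_generator P f h : Prop :=
  [/\ f \in Lfun mu 2%:E, h \in Lfun mu 2%:E &
      L2norm (fun x => (P t f x - f x) / t - h x) @[t --> (0 : R)^'+] --> 0%E].

(* The strongly continuous symmetric contraction semigroup e^{tL} on L^2
   generated by the self-adjoint operator L associated with the form. *)
Record heat_semigroup F E P : Prop := {
  hs_L2 : forall (t : R) f, 0 < t -> f \in Lfun mu 2%:E ->
    P t f \in Lfun mu 2%:E ;
  hs_lin : forall (t a : R) f g, 0 < t ->
    f \in Lfun mu 2%:E -> g \in Lfun mu 2%:E ->
    {ae mu, forall x, P t (fun z => a * f z + g z) x = a * P t f x + P t g x} ;
  hs_contraction : forall (t : R) f, 0 < t -> f \in Lfun mu 2%:E ->
    (L2norm (P t f) <= L2norm f)%E ;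
  hs_sym : forall (t : R) f g, 0 < t ->
    f \in Lfun mu 2%:E -> g \in Lfun mu 2%:E ->
    L2dot (P t f) g = L2dot f (P t g) ;
  hs_semigroup : forall (s t : R) f, 0 < s -> 0 < t -> f \in Lfun mu 2%:E ->
    {ae mu, forall x, P (s + t) f x = P s (P t f) x} ;
  hs_continuous : forall f, f \in Lfun mu 2%:E ->
    L2norm (P t f \- f) @[t --> (0 : R)^'+] --> 0%E ;
  hs_generator : forall f h,
    semigroup_generator P f h <-> form_generator F E f h
}.

Implicit Type p : R -> X -> X -> R.

Definition continuous_heat_kernel P p : Prop :=
  (forall (t : R) (x y : X), 0 < t ->
     {for (t, (x, y)), continuous (fun z : R * (X * X) => p z.1 z.2.1 z.2.2)}) /\
  (forall (t : R) f, 0 < t -> f \in Lfun mu 2%:E ->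
     {ae mu, forall x,
        mu.-integrable [set: X] (fun y => (p t x y * f y)%:E) /\
        P t f x = \int[mu]_y (p t x y * f y)}).

(* "mu x mu-a.e." is spelled with [negligible], since [mu \x mu] is only
   declared as a measure when mu is bundled as sigma-finite. *)
Definition sub_gaussian_estimates (dH dW : R) p : Prop :=
  2 <= dW /\ exists c3 c4 c5 c6 : R, [/\ 0 < c3, 0 < c4, 0 < c5, 0 < c6 &
    (mu \x mu)%E.-negligible (~` [set z : X * X | forall t : R, 0 < t ->
      c5 * t `^ (- (dH / dW)) *
        expR (- c6 * (mdist z.1 z.2 `^ dW / t) `^ (dW - 1)^-1)
      <= p t z.1 z.2 <=
      c3 * t `^ (- (dH / dW)) *
        expR (- c4 * (mdist z.1 z.2 `^ dW / t) `^ (dW - 1)^-1)])].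

(* The extension of P_t to L^oo, defined at every point by means of p. *)
Definition kernel_semigroup p (t : R) g (x : X) : R :=
  \int[mu]_y (p t x y * g y).

Definition bakry_emery (dW : R) p : Prop :=
  exists kappa : R, [/\ 0 < kappa, kappa < dW,
    (dW - kappa)%:E = ereal_sup [set lambda%:E | lambda in
       [set lambda : R | 0 < lambda /\
          exists2 f, KS mu lambda 1 f & ae_nonconstant mu f]]
  & exists2 C : R, 0 < C & forall (t : R) g (x y : X), 0 < t ->
      g \in Lfun mu +oo%E ->
      ((`|kernel_semigroup p t g x - kernel_semigroup p t g y|)%:E <=
       (C * (mdist x y `^ kappa / t `^ (kappa / dW)))%:E *
       'N[mu]_+oo [EFin \o g])%E].

End dirichlet_forms.

Section besov.
Context {R : realType} {d : measure_display} {X : borelMetricType R d}.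
Variable mu : {measure set X -> \bar R}.

(* [eta t] is determined on ]0, +oo[ by continuity and by its Laplace
   transform. *)
Definition subordinator_density (delta : R) (eta : R -> R -> R) : Prop :=
  forall t : R, 0 < t ->
    [/\ forall s : R, 0 < s -> 0 <= eta t s,
        forall s : R, 0 < s -> {for s, continuous (eta t)}
      & forall lambda : R, 0 < lambda ->
          (\int[lebesgue_measure]_(s in `]0%R, +oo[)
             (eta t s * expR (- (s * lambda)))%:E)%E =
          (expR (- (t * lambda `^ delta)))%:E].

Definition subordinated_kernel (eta : R -> R -> R) (p : R -> X -> X -> R)
    (t : R) (x y : X) : \bar R :=
  (\int[lebesgue_measure]_(s in `]0%R, +oo[) (eta t s * p s x y)%:E)%E.

Variable pd : R -> X -> X -> \bar R.

Definition besov_seminorm (p alpha : R) (f : X -> R) : \bar R :=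
  ereal_sup [set ((t `^ (- alpha))%:E *
    (\int[mu]_y \int[mu]_x ((`|f x - f y| `^ p)%:E * pd t x y)) `^ p^-1)%E
    | t in [set t : R | 0 < t]].

Definition besov (p alpha : R) : set (X -> R) :=
  [set f | f \in Lfun mu p%:E /\ (besov_seminorm p alpha f < +oo)%E].

End besov.

(* Main.v *)
Require Import Defs.
From HB Require Import structures.
From mathcomp Require Import all_boot all_order all_algebra.
From mathcomp Require Import all_classical all_reals all_analysis.
From mathcomp Require Import measurable_realfun ring lra.

(** The inequality is the fractional Sobolev embedding of order
    [s = delta * dW < D = dH] and exponent 1.  It holds for all functions in L^1
    on every metric measure space whose balls satisfy
    [mu (ball x r) >= c * r `^ D], and it is proved in that generality, for any
    [0 < s < D].

    Let [q = D / (D - s)], so that [q - 1 = q * s / D], and let [g >= 0] have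
    [I = \int g^q] finite.  Fix [x] with [g x > 0] and put [a = g x / 2].  By
    Chebyshev the set [A = {g >= a}] has measure at most [m = I / a^q], so a ball
    around [x] of measure at least [2 * m], whose radius [r] can be taken to
    satisfy [c * r^D = 2 * m], contains a set of measure [m] on which
    [|g x - g y| >= a].  Hence ([tail_energy_ge])
      [\int_y |g x - g y| / d(x,y)^(D + s) >= a * m * r^(-(D + s))],
    which is a constant times [a * m^(-s/D) = I^(-s/D) * a^q].  Integrating in
    [x] gives a constant times [I^(1 - s/D) = I^(1/q)], that is, the inequality
    for [g] ([fractional_sobolev_finite]).

    Finiteness of [I] is what allows [I] to be moved to one side.  For
    [f \in L^1] it holds for the truncations [g_n = min |f| n], since
    [g_n^q <= n^(q-1) * |f|]; truncation does not increase [|f x - f y|], and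
    monotone convergence lets [n] go to infinity ([fractional_sobolev]). *)

Set Implicit Arguments.
Unset Strict Implicit.
Unset Printing Implicit Defensive.

Import Order.TTheory GRing.Theory Num.Theory.
Import numFieldNormedType.Exports.

Local Open Scope classical_set_scope.
Local Open Scope ring_scope.

(** The integral of a nonnegative function is a supremum over the simple
    functions below it, hence monotone with no measurability at all.  This spares
    proving that [mdist] is jointly measurable, which would
    rest on separability of the space. *)
Lemma ge0_le_integral_nonmeasurable d (T : measurableType d) (R : realType)
    (mu : {measure set T -> \bar R}) (f g : T -> \bar R) :
  (forall x, 0 <= f x)%E -> (forall x, f x <= g x)%E ->
  (\int[mu]_x f x <= \int[mu]_x g x)%E.
Proof.
move=> f0 fg.
have g0 x : (0 <= g x)%E by exact: le_trans (f0 x) (fg x).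
rewrite !ge0_integralTE//; apply: ereal_sup_le => _ [h hf <-].
by exists h => // x; exact: le_trans (hf x) (fg x).
Qed.

Lemma metric_ball_open (R : realType) (X : metricType R) (x : X) (r : R) :
  open (ball x r).
Proof.
rewrite openE => y xy; apply/nbhs_ballP.
have xyr : mdist x y < r by move: xy; rewrite ballEmdist.
have e0 : 0 < (r - mdist x y) / 2 by rewrite divr_gt0// subr_gt0.
exists ((r - mdist x y) / 2) => // z yz.
have -> : r = (r + mdist x y) / 2 + (r - mdist x y) / 2 by lra.
by apply: ball_triangle yz; rewrite ballEmdist /=; lra.
Qed.

Lemma measurable_metric_ball (R : realType) d (X : borelMetricType R d)
  (x : X) (r : R) : measurable (ball x r).
Proof.
rewrite borel_measurableE; apply: sub_sigma_algebra; exact: metric_ball_open.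
Qed.

Section fractional_sobolev.
Context {R : realType} {d : measure_display} {X : borelMetricType R d}.
Variables (mu : {measure set X -> \bar R}) (D s c : R).
Hypotheses (D_gt0 : 0 < D) (s_gt0 : 0 < s) (s_lt : s < D) (c_gt0 : 0 < c).
Hypothesis ball_ge : forall (x : X) (r : R), 0 <= r ->
  ((c * r `^ D)%:E <= mu (ball x r))%E.

Local Notation q := (D / (D - s)).

(** The first factor comes from the choice of the radius in [tail_energy_ge], the
    second from the height [g x / 2] of the superlevel set. *)
Definition sobolev_const : R := (2 / c) `^ (- (1 + s / D)) * 2^-1 `^ q.

Lemma sobolev_const_gt0 : 0 < sobolev_const.
Proof. by rewrite mulr_gt0// powR_gt0// divr_gt0. Qed.

(** Off a set [A] of measure at most [m], the kernel [mdist x y `^ (- (D + s))]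
    has mass at least a constant times [m `^ (- (s / D))]: a ball around [x] of
    measure at least [2 * m] keeps measure at least [m] outside [A], and on it
    the kernel is bounded below by its value at the radius. *)
Lemma tail_energy_ge (u : X -> R) (A : set X) (x : X) (a m : R) :
  (forall y, 0 <= u y) -> u x = 0 -> measurable A -> 0 < a -> 0 < m ->
  (mu A <= m%:E)%E -> (forall y, ~ A y -> a <= u y) ->
  (((2 / c) `^ (- (1 + s / D)) * (a * m `^ (- (s / D))))%:E <=
   \int[mu]_y (u y / mdist x y `^ (D + s))%:E)%E.
Proof.
move=> u0 ux0 mA a0 m0 mAm ua.
have Ax : A x by apply: contrapT => /ua; rewrite ux0 leNgt a0.
(* The radius is chosen so that [c * r `^ D = 2 * m]. *)
pose b := 2 / c * m; have b0 : 0 < b by rewrite mulr_gt0// divr_gt0.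
pose r := b `^ D^-1; have r0 : 0 < r by exact: powR_gt0.
have rD : r `^ D = b by rewrite /r -powRrM mulVf ?gt_eqF// powRr1// ltW.
have mB := measurable_metric_ball x r.
have mBA : measurable (ball x r `\` A) by exact: measurableD.
have BA : (m%:E <= mu (ball x r `\` A))%E.
  have : ((2 * m)%:E <= mu (ball x r))%E.
    apply: le_trans (ball_ge x (ltW r0)); rewrite rD lee_fin /b.
    by rewrite mulrA mulrCA mulfV ?gt_eqF// mulr1.
  rewrite (measureDI mu mB mA) => /le_trans.
  move=> /(_ (mu (ball x r `\` A) + m%:E)%E).
  rewrite mulr_natl mulr2n EFinD leeD2rE//; apply.
  by apply: leeD => //; apply: le_trans mAm; apply: measureIr.
pose k := a * r `^ (- (D + s)).
have k0 : 0 <= k by rewrite mulr_ge0 ?powR_ge0// ltW.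
have intk : (\int[mu]_y (k%:E * (\1_(ball x r `\` A) y)%:E) =
             k%:E * mu (ball x r `\` A))%E.
  by rewrite ge0_integralZl//; [rewrite integral_indic// setIT
    |exact/measurable_EFinP].
apply: (@le_trans _ _ (k%:E * mu (ball x r `\` A))%E).
  apply: le_trans (lee_wpmul2l _ BA); last by rewrite lee_fin.
  rewrite -EFinM lee_fin le_eqVlt; apply/orP; left; apply/eqP; rewrite /k.
  have -> : r `^ (- (D + s)) = (2 / c) `^ (- (1 + s / D)) * m `^ (- (1 + s / D)).
    rewrite -powRM ?ltW// ?divr_gt0// /r -powRrM; congr (_ `^ _).
    by rewrite mulrN mulrDr mulVf ?gt_eqF// [s / D]mulrC.
  rewrite -!mulrA mulrCA; congr (_ * (_ * _)).
  rewrite -[X in _ = _ * X](powRr1 (ltW m0)) -powRD; last first.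
    by rewrite (gt_eqF m0) implybT.
  by congr (_ `^ _); lra.
rewrite -intk; apply: ge0_le_integral_nonmeasurable => y.
  by rewrite -EFinM lee_fin mulr_ge0.
rewrite -EFinM lee_fin indicE.
case: (boolP (y \in _)) => [/[!inE] -[Bxy Ay]|_]; last first.
  by rewrite mulr0 divr_ge0// powR_ge0.
(* At [y = x] the quotient is [0], because [0 `^ (D + s) = 0]; but [x] is in [A],
   so that the kernel is only compared at points with [mdist x y > 0]. *)
have xy : x != y by apply/eqP => xy; apply: Ay; rewrite -xy.
have dxy : 0 < mdist x y by rewrite mdist_gt0.
rewrite mulr1 /k powRN; apply: ler_pM.
- exact: ltW.
- by rewrite invr_ge0 powR_ge0.
- exact: ua.
- rewrite lef_pV2 ?posrE ?powR_gt0//.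
  apply: ge0_ler_powR; rewrite ?nnegrE; try by rewrite ltW// addr_gt0.
  by move: Bxy; rewrite ballEmdist => /ltW.
Qed.

Lemma chebyshev_powR (g : X -> R) (I a : R) :
  measurable_fun setT g -> (forall x, 0 <= g x) -> 0 < a ->
  (\int[mu]_x (g x `^ q)%:E = I%:E)%E ->
  (mu [set y | a <= g y]%R <= (I / a `^ q)%:E)%E.
Proof.
move=> mg g0 a0 gI.
have q0 : 0 < q by rewrite divr_gt0// subr_gt0.
have mA : measurable [set y | a <= g y].
  rewrite -[X in measurable X]setTI; apply: measurable_fun_le => //.
have aq0 : 0 < a `^ q by exact: powR_gt0.
have indE : (\int[mu]_y ((a `^ q)%:E * (\1_[set y | a <= g y] y)%:E) =
    (a `^ q)%:E * mu [set y | a <= g y]%R)%E.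
  rewrite ge0_integralZl//; first by rewrite integral_indic// setIT.
    exact/measurable_EFinP/measurable_indic.
  by rewrite lee_fin ltW.
rewrite EFinM lee_pdivlMr// muleC -indE -gI.
apply: ge0_le_integral_nonmeasurable => y.
  by rewrite -EFinM lee_fin mulr_ge0// ltW.
rewrite -EFinM lee_fin indicE; case: (boolP (y \in _)) => [/[!inE]/= ay|_].
  by rewrite mulr1 ge0_ler_powR ?nnegrE// ltW.
by rewrite mulr0 powR_ge0.
Qed.

Lemma sobolev_exponent_gt1 : 1 < q.
Proof. by rewrite ltr_pdivlMr ?subr_gt0// mul1r ltrBlDr ltrDl. Qed.

Lemma sobolev_exponentB1 : q - 1 = q * (s / D).
Proof.
have Ds : D - s != 0 by rewrite gt_eqF// subr_gt0.
have D0 : D != 0 by rewrite gt_eqF.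
by field; rewrite D0 Ds.
Qed.

(** The bound of [tail_energy_ge], applied at each [x] to the superlevel set of
    [g] at height [g x / 2], is proportional to [g x `^ q]: this is where the
    value of [q] comes from. *)
Lemma fractional_sobolev_finite (g : X -> R) (I : R) :
  measurable_fun setT g -> (forall x, 0 <= g x) ->
  (\int[mu]_x (g x `^ q)%:E = I%:E)%E ->
  ((sobolev_const * I `^ q^-1)%:E <=
   \int[mu]_x \int[mu]_y (`|g x - g y| / mdist x y `^ (D + s))%:E)%E.
Proof.
move=> mg g0 gI.
have q1 := sobolev_exponent_gt1; have q0 : 0 < q by exact: lt_trans q1.
have kernel_ge0 x y : 0 <= `|g x - g y| / mdist x y `^ (D + s).
  by rewrite divr_ge0// powR_ge0.
have K0 := ltW sobolev_const_gt0.
have I0 : 0 <= I.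
  by rewrite -lee_fin -gI; apply: integral_ge0 => x _; rewrite lee_fin powR_ge0.
have mgq : measurable_fun setT (fun x => (g x `^ q)%:E).
  by apply/measurable_EFinP; exact: (measurableT_comp (measurable_powR q) mg).
move: I0; rewrite le_eqVlt => /predU1P[I0|I0].
  rewrite -I0 powR0 ?invr_neq0 ?gt_eqF// mulr0.
  by apply: integral_ge0 => x _; apply: integral_ge0 => y _; rewrite lee_fin.
pose k := sobolev_const * I `^ (- (s / D)).
have k0 : 0 <= k by rewrite mulr_ge0// powR_ge0.
have -> : sobolev_const * I `^ q^-1 = k * I.
  rewrite /k -mulrA -[X in _ = _ * (_ * X)](powRr1 (ltW I0)) -powRD.
    congr (_ * _ `^ _).
    have Ds : D - s != 0 by rewrite gt_eqF// subr_gt0.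
    by field; rewrite Ds gt_eqF.
  by rewrite (gt_eqF I0) implybT.
rewrite EFinM -gI -ge0_integralZl//; last first.
  by move=> x _; rewrite lee_fin powR_ge0.
apply: ge0_le_integral_nonmeasurable => x.
  by rewrite -EFinM lee_fin mulr_ge0// powR_ge0.
(* Where [g] vanishes the lower bound is zero. *)
have := g0 x; rewrite le_eqVlt => /predU1P[gx0|gx0].
  rewrite -gx0 powR0 ?gt_eqF// mule0.
  by apply: integral_ge0 => y _; have := kernel_ge0 x y; rewrite -gx0 lee_fin.
pose a := g x * 2^-1; have a0 : 0 < a by rewrite mulr_gt0// invr_gt0.
have m0 : 0 < I / a `^ q by rewrite divr_gt0// powR_gt0.
have mA : measurable [set y | a <= g y].
  by rewrite -[X in measurable X]setTI; exact: measurable_fun_le.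
apply: le_trans (tail_energy_ge (u := fun y => `|g x - g y|) (x := x) _ _
  mA a0 m0 (chebyshev_powR mg g0 a0 gI) _); last first.
- move=> y /negP; rewrite -ltNge => gya.
  have xa : g x = a + a by rewrite /a; lra.
  by rewrite ler_normr; apply/orP; left; lra.
- by rewrite subrr normr0.
- by [].
rewrite -EFinM lee_fin le_eqVlt; apply/orP; left; apply/eqP.
have -> : (I / a `^ q) `^ (- (s / D)) = I `^ (- (s / D)) * a `^ (q - 1).
  rewrite -powRN powRM ?powR_ge0 ?ltW// -powRrM.
  by rewrite mulrN mulNr opprK -sobolev_exponentB1.
have agq : a `^ q = 2^-1 `^ q * g x `^ q.
  by rewrite /a powRM ?ltW// ?invr_gt0// mulrC.
have aB1 : a `^ q = a * a `^ (q - 1) by rewrite mulr_powRB1// ltW.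
rewrite /k /sobolev_const [a * _]mulrCA -aB1 agq.
by rewrite -!mulrA; congr (_ * _); rewrite mulrCA.
Qed.

Lemma fractional_sobolev (f : X -> R) : f \in Lfun mu 1 ->
  ('N[mu]_q%:E [EFin \o f] <=
   (sobolev_const^-1)%:E *
   \int[mu]_x \int[mu]_y (`|f x - f y| / mdist x y `^ (D + s))%:E)%E.
Proof.
move=> /Lfun1_integrable /integrableP[/measurable_EFinP mf intf].
have q1 := sobolev_exponent_gt1; have q0 : 0 < q by exact: lt_trans q1.
set W := (\int[mu]_x _)%E.
have W0 : (0 <= W)%E.
  apply: integral_ge0 => x _; apply: integral_ge0 => y _.
  by rewrite lee_fin divr_ge0// powR_ge0.
have K0 := sobolev_const_gt0.
(* The truncations are bounded and in L^1, hence in L^q. *)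
pose g (n : nat) (x : X) : R := Num.min `|f x| n%:R.
have g0 n x : 0 <= g n x by rewrite le_min normr_ge0 ler0n.
have mg n : measurable_fun setT (g n).
  apply: measurable_minr => //; exact: measurableT_comp.
have gf n x : g n x <= `|f x| by rewrite ge_min lexx.
have mgq n : measurable_fun setT (fun x => (g n x `^ q)%:E).
  apply/measurable_EFinP.
  exact: (measurableT_comp (measurable_powR q) (mg n)).
have g_lip n x y : `|g n x - g n y| <= `|f x - f y|.
  apply: le_trans (ler_dist_dist (f x) (f y)).
  rewrite /g; move: `|f x| `|f y| => b c'.
  case: (leP b n%:R) => bn; case: (leP c' n%:R) => cn //.
  - by rewrite !ler0_norm; lra.
  - by rewrite !ger0_norm; lra.
  - by rewrite subrr normr0.
have WgW n : (\int[mu]_x \int[mu]_y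
    (`|g n x - g n y| / mdist x y `^ (D + s))%:E <= W)%E.
  apply: ge0_le_integral_nonmeasurable => x.
    by apply: integral_ge0 => y _; rewrite lee_fin divr_ge0// powR_ge0.
  apply: ge0_le_integral_nonmeasurable => y.
    by rewrite lee_fin divr_ge0// powR_ge0.
  by rewrite lee_fin ler_wpM2r// invr_ge0 powR_ge0.
pose Z := ((sobolev_const^-1)%:E * W)%E.
have Z0 : (0 <= Z)%E by rewrite mule_ge0// lee_fin invr_ge0 ltW.
have gZ n : (\int[mu]_x (g n x `^ q)%:E <= Z `^ q)%E.
  have g_fin : (\int[mu]_x (g n x `^ q)%:E < +oo)%E.
    have le1 x : ((g n x `^ q)%:E <= (n%:R `^ (q - 1))%:E * (`|f x|)%:E)%E.
      rewrite -EFinM lee_fin -mulr_powRB1// mulrC ler_pM ?powR_ge0//.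
      by rewrite ge0_ler_powR ?nnegrE ?subr_ge0 ?(ltW q1)// ge_min lexx orbT.
    apply: le_lt_trans (ge0_le_integral_nonmeasurable mu _ le1) _.
      by move=> x; rewrite lee_fin powR_ge0.
    rewrite ge0_integralZl ?lee_fin ?powR_ge0//; last first.
      by apply/measurable_EFinP; exact: measurableT_comp.
    by rewrite lte_mul_pinfty ?lee_fin ?powR_ge0.
  have I0 : (0 <= \int[mu]_x (g n x `^ q)%:E)%E.
    by apply: integral_ge0 => x _; rewrite lee_fin powR_ge0.
  case gI : (\int[mu]_x (g n x `^ q)%:E)%E g_fin I0 => [I| |] // _.
  rewrite lee_fin => I0.
  have : ((I `^ q^-1)%:E <= Z)%E.
    rewrite /Z lee_pdivlMl// -EFinM.
    exact: le_trans (fractional_sobolev_finite (mg n) (g0 n) gI) (WgW n).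
  move/(gt0_ler_poweR (ltW q0)).
  rewrite !in_itv/= !leey !lee_fin powR_ge0 Z0 => /(_ isT isT).
  by rewrite -powRrM mulVf ?gt_eqF// powRr1.
have fZ : (\int[mu]_x (`|f x| `^ q)%:E <= Z `^ q)%E.
  have flim x : limn (fun n => (g n x `^ q)%:E) = (`|f x| `^ q)%:E.
    apply: lim_near_cst => //; near=> n; congr (_ `^ _)%:E.
    by apply/min_idPl; near: n; exact: nbhs_infty_ger.
  have gnd x : nondecreasing_seq (fun n => (g n x `^ q)%:E).
    move=> n m nm; rewrite lee_fin ge0_ler_powR ?nnegrE ?(ltW q0)//.
    by rewrite /g le_min !ge_min lexx/= ler_nat nm orbT.
  under eq_integral do rewrite -flim.
  rewrite monotone_convergence//; last first.
    by move=> n x _; rewrite lee_fin powR_ge0.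
  apply: lime_le; last by apply: nearW => n; exact: gZ.
  apply: ereal_nondecreasing_is_cvgn => n m nm.
  apply: ge0_le_integral_nonmeasurable => x; last exact: gnd.
  by rewrite lee_fin powR_ge0.
rewrite unlock -/Z.
have -> : Z = ((Z `^ q) `^ q^-1)%E by rewrite -poweRrM mulfV ?gt_eqF// poweRe1.
apply: gt0_ler_poweR; rewrite ?invr_ge0 ?(ltW q0)// in_itv/= ?leey ?poweR_ge0//.
by rewrite andbT integral_ge0// => x _; rewrite lee_fin powR_ge0.
Unshelve. all: by end_near. Qed.

End fractional_sobolev.

Theorem theorem4p10 (R : realType) (d : measure_display)
    (X : borelMetricType R d) (mu : {measure set X -> \bar R})
    (F : set (X -> R)) (E : (X -> R) -> (X -> R) -> R)
    (P : R -> (X -> R) -> (X -> R)) (p : R -> X -> X -> R)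
    (eta : R -> R -> R) (dH dW delta : R)
    (X_locally_compact : locally_compact [set: X])
    (mu_radon : radon_measure mu)
    (mu_full_support : full_support mu)
    (E_dirichlet : dirichlet_form mu F E)
    (P_heat_semigroup : heat_semigroup mu F E P)
    (balls_precompact : forall (x : X) (r : R), compact (closure (ball x r)))
    (mu_ahlfors : ahlfors_regular mu dH)
    (E_regular : regular_form mu F E)
    (E_strongly_local : strongly_local mu F E)
    (p_heat_kernel : continuous_heat_kernel mu P p)
    (p_estimates : sub_gaussian_estimates mu dH dW p)
    (p_bakry_emery : bakry_emery mu dW p)
    (delta_gt0 : 0 < delta) (delta_lt1 : delta < 1)
    (eta_density : subordinator_density delta eta)
    (dH_gt : delta * dW < dH) :
  exists2 C : R, 0 < C &
    forall f : X -> R, besov mu (subordinated_kernel eta p) 1 1 f ->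
      ('N[mu]_(dH / (dH - delta * dW))%:E [EFin \o f] <=
       C%:E * \int[mu]_x \int[mu]_y
         (`|f x - f y| / mdist x y `^ (dH + delta * dW))%:E)%E.
Proof.
have [D_gt0 [c1 [c2 [c1_gt0 _ ball_bounds]]]] := mu_ahlfors.
have s_gt0 : 0 < delta * dW.
  by rewrite mulr_gt0//; case: p_estimates => dW2 _; exact: lt_le_trans dW2.
have ball_ge (x : X) (r : R) : 0 <= r -> ((c1 * r `^ dH)%:E <= mu (ball x r))%E.
  by move=> /(ball_bounds x) /andP[].
exists (sobolev_const dH (delta * dW) c1)^-1.
  by rewrite invr_gt0; exact: sobolev_const_gt0.
move=> f [f_L1 _].
exact: (fractional_sobolev D_gt0 s_gt0 dH_gt c1_gt0 ball_ge f_L1).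
Qed.
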